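(* Let $\mathbb{A}=Alg\,\mathcal{L}$ be a reflexive algebra on a Hilbert space $\mathbb{H}$, where $\mathcal{L}$ is a subspace lattice on $\mathbb{H}$, and suppose there exists a non-trivial idempotent $P\in Alg\,\mathcal{L}$ with range $P(\mathbb{H})\in\mathcal{L}$. Let $\delta:Alg\,\mathcal{L}\to Alg\,\mathcal{L}$ be a continuous linear map. Then $\delta$ satisfies \[ A,B\in\mathbb{A},\quad AB+BA=P\ \Longrightarrow\ 2A\delta(B)+2B\delta(A)=\delta(P) \] if and only if \[ \delta(A)=\alpha(A)+\beta(A)+PA(I-P)\delta(I)\quad\text{for all }A\in\mathbb{A}, \] where: (i) $\alpha:\mathbb{A}\to\mathbb{A}$ is a continuous linear map which is a Jordan left derivation and $\alpha(A)=P\alpha(PAP)$ for all $A\in\mathbb{A}$; (ii) $\beta:\mathbb{A}\to\mathbb{A}$ is a continuous linear map satisfying \[ \beta(A)=(I-P)\beta\big((I-P)A(I-P)\big)(I-P)\quad\text{for all }A\in\mathbb{A}, \] for all $A,B\in\mathbb{A}$, \[ (I-P)A(I-P)B(I-P)+(I-P)B(I-P)A(I-P)=0\ \Longrightarrow\ (I-P)A\beta(B)+(I-P)B\beta(A)=0, \] and \[ PA(I-P)\beta(B)=PA(I-P)B(I-P)\delta(I)\quad\text{for all }A,B\in\mathbb{A}. \]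
   Context: All algebras and vector spaces are over $\mathbb{F}$, where $\mathbb{F}$ is either $\mathbb{R}$ or $\mathbb{C}$. $\mathcal{B}(\mathbb{H})$ is the algebra of bounded linear operators on $\mathbb{H}$ and $I$ is the identity operator. A subspace lattice $\mathcal{L}$ on $\mathbb{H}$ is a collection of norm-closed subspaces of $\mathbb{H}$ that is closed under arbitrary intersections and arbitrary closed linear spans and contains $\{0\}$ and $\mathbb{H}$. $Alg\,\mathcal{L}=\{T\in\mathcal{B}(\mathbb{H}) : T(L)\subseteq L \text{ for all } L\in\mathcal{L}\}$; reflexive algebras are exactly the algebras of this form. An idempotent $P$ is non-trivial if $P\neq 0$ and $P\neq I$ (it need not be self-adjoint). A linear map $\alpha:\mathbb{A}\to\mathbb{A}$ is a Jordan left derivation if $\alpha(AB+BA)=2A\alpha(B)+2B\alpha(A)$ for all $A,B\in\mathbb{A}$; equivalently, $\alpha(A^2)=2A\alpha(A)$ for all $A\in\mathbb{A}$. Continuity refers to the operator norm. *)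

(* Defs.v *)
From HB Require Import structures.
From mathcomp Require Export all_boot all_order all_algebra complex.
From mathcomp Require Export all_classical all_reals topology normedtype.

Set Implicit Arguments.
Unset Strict Implicit.
Unset Printing Implicit Defensive.

Export Order.TTheory GRing.Theory Num.Theory.
Export numFieldNormedType.Exports.

Open Scope classical_set_scope.
Open Scope ring_scope.

(* The scalar field is R or C = R[i], where R is an arbitrary realType. *)

Variant scalar_kind := RealScalars | ComplexScalars.

Definition scalars (R : realType) (k : scalar_kind) : numFieldType :=
  match k with RealScalars => R | ComplexScalars => R[i] end.

Definition scalar_conj (R : realType) (k : scalar_kind) :
    scalars R k -> scalars R k :=
  match k with RealScalars => idfun | ComplexScalars => Num.conj end.

Definition scalar_re (R : realType) (k : scalar_kind) : scalars R k -> R :=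
  match k with RealScalars => idfun | ComplexScalars => @complex.Re R end.

Definition scalar_of_real (R : realType) (k : scalar_kind) :
    R -> scalars R k :=
  match k with RealScalars => idfun | ComplexScalars => @real_complex R end.
Arguments scalar_of_real {R} k.

Section ScalarTheory.
Context {R : realType} {k : scalar_kind}.
Local Notation K := (scalars R k).

Lemma scalar_of_realK : cancel (@scalar_of_real R k) (@scalar_re R k).
Proof. by case: k. Qed.

Lemma scalar_reK (x : K) : 0 <= x -> scalar_of_real k (scalar_re x) = x.
Proof.
case: k x => //= -[a b]; rewrite lecE /= => /andP[/eqP b0 _].
by rewrite /real_complex_def -b0.
Qed.

Lemma ler_scalar_of_real (a b : R) :
  (scalar_of_real k a <= scalar_of_real k b) = (a <= b).
Proof. by case: k => //=; exact: lecR. Qed.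

Lemma ler_scalar_re (x y : K) : 0 <= x -> 0 <= y ->
  (scalar_re x <= scalar_re y) = (x <= y).
Proof. by move=> x0 y0; rewrite -ler_scalar_of_real !scalar_reK. Qed.

Lemma scalar_of_realD (a b : R) :
  scalar_of_real k (a + b) = scalar_of_real k a + scalar_of_real k b.
Proof. by case: k => //=; exact: rmorphD. Qed.

Lemma scalar_of_realM (a b : R) :
  scalar_of_real k (a * b) = scalar_of_real k a * scalar_of_real k b.
Proof. by case: k => //=; exact: rmorphM. Qed.

Lemma scalar_of_real0 : scalar_of_real k (0 : R) = 0.
Proof. by case: k. Qed.

End ScalarTheory.

Section BoundedOperators.
Context {R : realType} {k : scalar_kind}.
Local Notation K := (scalars R k).
Variable H : normedModType K.

Definition bounded_operator : {pred H -> H} :=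
  [pred T | `[< linear T /\ exists M : K, forall x, `|T x| <= M * `|x| >]].

Lemma bounded_operatorP (T : H -> H) :
  reflect (linear T /\ exists M : K, forall x, `|T x| <= M * `|x|)
          (T \in bounded_operator).
Proof. by rewrite inE; exact: asboolP. Qed.

Lemma bounded_operator_ge0 (T : H -> H) : T \in bounded_operator ->
  exists2 M : K, 0 <= M & forall x, `|T x| <= M * `|x|.
Proof.
move=> /bounded_operatorP[_ [M MT]].
have [x0|nx] := pselect (exists x : H, x != 0).
  have [x x0'] := x0; exists M => //.
  by rewrite -(pmulr_lge0 (x := `|x|)) ?normr_gt0// (le_trans _ (MT x)).
exists 0 => // x; rewrite mul0r (le_trans (MT x))//.
have -> : x = 0 by apply/eqP/negPn/negP => xn0; apply: nx; exists x.
by rewrite normr0 mulr0.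
Qed.

Fact bounded_operator_submod : submod_closed bounded_operator.
Proof.
split=> [|a S T S_ T_]; apply/bounded_operatorP.
  split; first by move=> c x y; rewrite scaler0 addr0.
  by exists 0 => x; rewrite normr0 mul0r.
have [M _ SM] := bounded_operator_ge0 S_.
have [N _ TN] := bounded_operator_ge0 T_.
have [lS _] := bounded_operatorP _ S_; have [lT _] := bounded_operatorP _ T_.
split.
  move=> c x y; rewrite !fctE lS lT !scalerDr !scalerA (mulrC c a).
  by rewrite -!addrA; congr (_ + _); rewrite addrCA.
exists (`|a| * M + N) => x; rewrite !fctE (le_trans (ler_normD _ _))// mulrDl.
by rewrite lerD// normrZ -mulrA ler_wpM2l.
Qed.

HB.instance Definition _ :=
  GRing.isSubmodClosed.Build K (H -> H) bounded_operator
    bounded_operator_submod.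

Record boundedOp := BoundedOp { boundedOp_fun :> H -> H; boundedOp_subproof : boundedOp_fun \in bounded_operator }.

HB.instance Definition _ := [isSub for boundedOp_fun].
HB.instance Definition _ := [Choice of boundedOp by <:].
HB.instance Definition _ := [SubChoice_isSubLmodule of boundedOp by <:].

Lemma boundedOpP (S T : boundedOp) : S =1 T -> S = T.
Proof. by move=> ST; apply/val_inj/funext. Qed.

Fact boundedOp_linear (T : boundedOp) : linear T.
Proof. by have /bounded_operatorP[] := boundedOp_subproof T. Qed.

HB.instance Definition _ (T : boundedOp) :=
  GRing.isLinear.Build K H H *:%R T (boundedOp_linear T).

Fact boundedOp_one_subproof : (@idfun H : H -> H) \in bounded_operator.
Proof. by apply/bounded_operatorP; split => //; exists 1 => x; rewrite mul1r. Qed.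

Definition boundedOp_one : boundedOp := BoundedOp boundedOp_one_subproof.

Fact boundedOp_mul_subproof (S T : boundedOp) : (S \o T : H -> H) \in bounded_operator.
Proof.
apply/bounded_operatorP; split=> [c x y|]; first by rewrite /= !linearP.
have [M M0 SM] := bounded_operator_ge0 (boundedOp_subproof S).
have [N N0 TN] := bounded_operator_ge0 (boundedOp_subproof T).
exists (M * N) => x /=; rewrite (le_trans (SM _))// -mulrA.
by rewrite ler_wpM2l.
Qed.

Definition boundedOp_mul (S T : boundedOp) : boundedOp := BoundedOp (boundedOp_mul_subproof S T).

Fact boundedOp_mulA : associative boundedOp_mul. Proof. by move=> S T U; exact: boundedOpP. Qed.
Fact boundedOp_mul1l : left_id boundedOp_one boundedOp_mul. Proof. by move=> S; exact: boundedOpP. Qed.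
Fact boundedOp_mul1r : right_id boundedOp_one boundedOp_mul. Proof. by move=> S; exact: boundedOpP. Qed.
Fact boundedOp_mulDl : left_distributive boundedOp_mul +%R.
Proof. by move=> S T U; exact: boundedOpP. Qed.
Fact boundedOp_mulDr : right_distributive boundedOp_mul +%R.
Proof. by move=> S T U; apply: boundedOpP => x; exact: linearD. Qed.

HB.instance Definition _ := GRing.Zmodule_isPzRing.Build boundedOp
  boundedOp_mulA boundedOp_mul1l boundedOp_mul1r boundedOp_mulDl boundedOp_mulDr.

(* ||T|| = sup of |T x| over |x| <= 1. The norm of H has values in the scalars, so
   the supremum is taken in R and injected back. *)
Definition opnorm (T : boundedOp) : K :=
  scalar_of_real k (sup [set scalar_re `|T x| | x in [set x | `|x| <= 1]]).

Let bounded_set (T : boundedOp) :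
  has_sup [set scalar_re `|T x| | x in [set x | `|x| <= 1]].
Proof.
split; first by exists (scalar_re `|T 0|), 0 => //=; rewrite normr0 ler01.
have [M M0 TM] := bounded_operator_ge0 (boundedOp_subproof T).
exists (scalar_re M) => _ [x x1 <-]; rewrite ler_scalar_re//.
by rewrite (le_trans (TM x))// ler_piMr.
Qed.

Lemma opnorm_ge0 (T : boundedOp) : 0 <= opnorm T.
Proof.
rewrite -scalar_of_real0 ler_scalar_of_real.
rewrite -(ler_scalar_of_real (k := k)) scalar_of_real0.
apply: (@le_trans _ _ `|T 0|) => //.
rewrite -(scalar_reK (normr_ge0 (T 0))) ler_scalar_of_real.
apply: ub_le_sup; first by case: (bounded_set T).
by exists 0 => //=; rewrite normr0 ler01.
Qed.

Lemma ler_opnorm (T : boundedOp) (x : H) : `|T x| <= opnorm T * `|x|.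
Proof.
have [->|x0] := eqVneq x 0; first by rewrite linear0 !normr0 mulr0.
rewrite -ler_pdivrMr ?normr_gt0//.
have -> : `|T x| / `|x| = `|T (`|x|^-1 *: x)|.
  by rewrite linearZ normrZ normfV normr_id mulrC.
rewrite -[leLHS]scalar_reK// ler_scalar_of_real.
apply: ub_le_sup; first by case: (bounded_set T).
exists (`|x|^-1 *: x) => //=.
by rewrite normrZ normfV normr_id mulVf ?normr_eq0.
Qed.

Lemma opnorm_le (T : boundedOp) (M : K) : 0 <= M ->
  (forall x, `|T x| <= M * `|x|) -> opnorm T <= M.
Proof.
move=> M0 TM; rewrite -[leRHS]scalar_reK// ler_scalar_of_real.
apply: ge_sup; first by case: (bounded_set T).
move=> _ [x x1 <-]; rewrite ler_scalar_re//.
by rewrite (le_trans (TM x))// ler_piMr.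
Qed.

Fact opnormD (S T : boundedOp) : opnorm (S + T) <= opnorm S + opnorm T.
Proof.
apply: opnorm_le => [|x]; first by rewrite addr_ge0 ?opnorm_ge0.
by rewrite (le_trans (ler_normD _ _))// mulrDl lerD// ler_opnorm.
Qed.

Let opnormZ_le (a : K) (T : boundedOp) : opnorm (a *: T) <= `|a| * opnorm T.
Proof.
apply: opnorm_le => [|x]; first by rewrite mulr_ge0 ?opnorm_ge0.
by rewrite [leLHS]normrZ -mulrA ler_wpM2l// ler_opnorm.
Qed.

Fact opnormZ (a : K) (T : boundedOp) : opnorm (a *: T) = `|a| * opnorm T.
Proof.
apply/le_anti; rewrite opnormZ_le/=.
have [->|a0] := eqVneq a 0; first by rewrite normr0 mul0r opnorm_ge0.
rewrite -ler_pdivlMl ?normr_gt0// -normfV.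
by have := opnormZ_le a^-1 (a *: T); rewrite scalerA mulVf// scale1r.
Qed.

Fact opnorm_eq0 (T : boundedOp) : opnorm T = 0 -> T = 0.
Proof.
move=> T0; apply: boundedOpP => x; apply/eqP; rewrite -normr_le0.
by have := ler_opnorm T x; rewrite T0 mul0r.
Qed.

HB.instance Definition _ :=
  Lmodule_isNormed.Build K boundedOp opnormD opnormZ opnorm_eq0.

Definition subspace (A : set H) : Prop :=
  A 0 /\ forall (a : K) x y, A x -> A y -> A (a *: x + y).

Definition closed_span (A : set H) : set H := closure (smallest subspace A).

Definition subspace_lattice (L : set (set H)) : Prop :=
  [/\ L `<=` [set A | subspace A /\ closed A],
      L [set 0], L [set: H],
      forall F, F `<=` L -> L (\bigcap_(A in F) A) &
      forall F, F `<=` L -> L (closed_span (\bigcup_(A in F) A))].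

Record subspaceLattice := SubspaceLattice {
  lattice_set : set (set H);
  lattice_axiom : subspace_lattice lattice_set }.

Section Alg.
Variable L : subspaceLattice.

Definition leaves_invariant : {pred boundedOp} :=
  [pred T : boundedOp | `[< forall A, lattice_set L A -> T @` A `<=` A >]].

Lemma leaves_invariantP (T : boundedOp) :
  reflect (forall A, lattice_set L A -> T @` A `<=` A) (T \in leaves_invariant).
Proof. by rewrite inE; exact: asboolP. Qed.

Let lattice_subspace (A : set H) : lattice_set L A -> subspace A.
Proof. by case: L => l [/= Ls _ _ _ _] /Ls[]. Qed.

Fact leaves_invariant_subring : subring_closed leaves_invariant.
Proof.
split; first by apply/leaves_invariantP => A _ _ [x Ax <-].
- move=> S T /leaves_invariantP SL /leaves_invariantP TL.
  apply/leaves_invariantP => A LA _ [x Ax <-].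
  have [_ Aadd] := lattice_subspace LA.
  have -> : (S - T) x = -1 *: T x + S x by rewrite scaleN1r addrC.
  by apply: Aadd; [apply: (TL _ LA)|apply: (SL _ LA)]; exists x.
- move=> S T /leaves_invariantP SL /leaves_invariantP TL.
  apply/leaves_invariantP => A LA _ [x Ax <-].
  by apply: (SL _ LA); exists (T x) => //; apply: (TL _ LA); exists x.
Qed.

HB.instance Definition _ :=
  GRing.isSubringClosed.Build boundedOp leaves_invariant
    leaves_invariant_subring.

Fact leaves_invariant_scale : GRing.scaler_closed leaves_invariant.
Proof.
move=> a T /leaves_invariantP TL; apply/leaves_invariantP => A LA _ [x Ax <-].
have [A0 Aadd] := lattice_subspace LA.
have -> : (a *: T) x = a *: T x + 0 by rewrite addr0.
by apply: Aadd => //; apply: (TL _ LA); exists x.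
Qed.

HB.instance Definition _ :=
  GRing.isScaleClosed.Build K boundedOp leaves_invariant
    leaves_invariant_scale.

(* P * Q in Alg L is the composite P \o Q, 1 is the identity operator, and `|P| is
   the operator norm of P; topological notions on Alg L refer to it. *)
Record Alg := MkAlg {
  Alg_op :> boundedOp;
  Alg_subproof : Alg_op \in leaves_invariant }.

HB.instance Definition _ := [isSub for Alg_op].
HB.instance Definition _ := [Choice of Alg by <:].
HB.instance Definition _ := [SubChoice_isSubZmodule of Alg by <:].
HB.instance Definition _ :=
  GRing.SubZmodule_isSubPzRing.Build boundedOp leaves_invariant Alg
    (GRing.subringClosedP _).
HB.instance Definition _ := [SubZmodule_isSubLmodule of Alg by <:].

Let Alg_norm (T : Alg) : K := `|Alg_op T|.

Fact Alg_normD (S T : Alg) : Alg_norm (S + T) <= Alg_norm S + Alg_norm T.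
Proof. exact: ler_normD. Qed.

Fact Alg_normZ (a : K) (T : Alg) : Alg_norm (a *: T) = `|a| * Alg_norm T.
Proof. exact: normrZ. Qed.

Fact Alg_norm_eq0 (T : Alg) : Alg_norm T = 0 -> T = 0.
Proof. by move=> /normr0_eq0 T0; exact: val_inj. Qed.

HB.instance Definition _ :=
  Lmodule_isNormed.Build K Alg Alg_normD Alg_normZ Alg_norm_eq0.

Definition jordan_left_derivation (alpha : Alg -> Alg) : Prop :=
  forall A B : Alg,
    alpha (A * B + B * A) = (A * alpha B) *+ 2 + (B * alpha A) *+ 2.

End Alg.
End BoundedOperators.

(* Main.v *)
From HB Require Import structures.
From mathcomp Require Import sequences.
Require Import Defs.

(* Since the range of [P] lies in the lattice, [(1 - P) X P = 0] for every [X],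
   so the algebra is upper triangular with respect to [P]. The relation
   [A B + B A = P] gives [delta P = 0] and is then exploited through explicit
   pairs: [A = P Y P + (1 - P)], [B = P Y^-1 P] for the corner [P X P],
   [A = P + S], [B = P + T] with [S T + T S = 0] for the corner
   [(1 - P) X (1 - P)], and [A = P + M], [B = P - M - M S + S] with
   [M = P M (1 - P)], [S = (1 - P) S (1 - P)] for the off-diagonal part
   ([A] and [B] normalised so that [A B + B A = 2 P]). On the first corner this
   yields [Y D(Y^-1) + Y^-1 D(Y) = 0], and applying it to [X], [1 - X] and
   [X (1 - X)] gives [D(X^2) = 2 X D(X)] whenever [X] and [1 - X] are invertible;
   a translate of any [X] by a large scalar has this property. *)

(** * Jordan left derivations from an identity on inverse pairs *)

Lemma jordan_square_of_inverses (A : pzRingType) (D : {additive A -> A}) :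
  D 1 = 0 ->
  (forall Y Z, Y * Z = 1 -> Z * Y = 1 -> Y * D Z + Z * D Y = 0) ->
  forall X X' V' : A, X * X' = 1 -> X' * X = 1 ->
    (1 - X) * V' = 1 -> V' * (1 - X) = 1 ->
  D (X * X) = (X * D X) *+ 2.
Proof.
move=> D1 DI X X' V'; set V := 1 - X => XX' X'X VV' V'V.
have XV : X * V = V * X by rewrite /V mulrBr mulrBl mulr1 mul1r.
have DV : D V = - D X by rewrite raddfB D1 sub0r.
set W := X * V; set W' := V' * X'.
have WW' : W * W' = 1 by rewrite mulrA -(mulrA X) VV' mulr1.
have W'W : W' * W = 1 by rewrite mulrA -(mulrA V') X'X mulr1.
(* Partial fractions: the inverse of [X (1 - X)] is the sum of the inverses of [X] and [1 - X]. *)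
have W'E : W' = X' + V'.
  have : V * W' * X = V * (X' + V') * X.
    rewrite mulrA VV' mul1r X'X mulrDr VV' mulrDl mul1r -mulrA X'X mulr1.
    by rewrite /V subrK.
  move=> /(congr1 (fun Z => V' * Z * X')).
  by rewrite !mulrA V'V !mul1r -!mulrA XX' !mulr1.
have XDX' : X * (X * D X') = - D X.
  have -> : X * D X' = - (X' * D X) by apply/eqP; rewrite -addr_eq0 DI.
  by rewrite mulrN mulrA XX' mul1r.
have VDV' : V * (V * D V') = D X.
  have -> : V * D V' = V' * D X by apply/eqP; rewrite -subr_eq0 -mulrN -DV DI.
  by rewrite mulrA VV' mul1r.
have DW : D W = - (W * (W * D W')).
  have /eqP : W * D W' + W' * D W = 0 by rewrite DI.
  by rewrite addr_eq0 => /eqP ->; rewrite mulrN opprK mulrA WW' mul1r.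
have WX : W * (W * D X') = - (V * (V * D X)).
  by rewrite /W XV -!mulrA (mulrA X V) XV -!mulrA XDX' !mulrN.
have WV : W * (W * D V') = X * (X * D X).
  by rewrite /W -!mulrA (mulrA V X) -XV -!mulrA VDV'.
have VX : V * (V * D X) - X * (X * D X) = D X - (X * D X) *+ 2.
  rewrite /V !(mulrBl, mulrBr) !mul1r opprB addrA addrAC addrK.
  by rewrite -addrA -opprD -mulr2n.
(* [D W] is computed a second time, now from [W = X - X^2], and compared with the value given by the
   inverse pair [W], [W']. *)
have : D W = D X - D (X * X) by rewrite /W /V mulrBr mulr1 raddfB.
rewrite DW W'E raddfD !mulrDr WX WV opprD opprK VX.
by move=> /addrI/oppr_inj.
Qed.

(** Polarization: expand at [X + Y] and cancel the two square terms. *)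
Lemma jordan_of_square (A : pzRingType) (D : {additive A -> A}) :
  (forall X, D (X * X) = (X * D X) *+ 2) ->
  forall X Y, D (X * Y + Y * X) = (X * D Y) *+ 2 + (Y * D X) *+ 2.
Proof.
move=> DS X Y; have := DS (X + Y).
rewrite !raddfD !mulrDl !mulrDr !raddfD /= !DS !mulrnDl => E.
apply: (addrI ((X * D X) *+ 2)); apply: (addIr ((Y * D Y) *+ 2)).
by move: E; rewrite !addrA.
Qed.

(** * Peirce calculus for a triangular idempotent *)

Section TriangularCompression.
Context {A : pzRingType} {e f : A}.
Hypothesis e_f : e + f = 1.
Hypothesis e_idem : e * e = e.
Hypothesis e_tri : forall X, X * e = e * X * e.

Let ef : e * f = 0.
Proof. by apply: (addrI (e * e)); rewrite -mulrDr e_f mulr1 e_idem addr0. Qed.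
Let fe : f * e = 0.
Proof. by apply: (addrI (e * e)); rewrite -mulrDl e_f mul1r e_idem addr0. Qed.
Let ff : f * f = f. Proof. by rewrite -[LHS]add0r -ef -mulrDl e_f mul1r. Qed.
Let fXe X : f * X * e = 0.
Proof. by rewrite -mulrA e_tri !mulrA fe !mul0r. Qed.

Let e_fix Z : f * Z = 0 -> e * Z = Z.
Proof. by move=> fZ; rewrite -[LHS]addr0 -fZ -mulrDl e_f mul1r. Qed.

(** Triangularity absorbs the middle [e]; hence inverse pairs compress to inverse pairs of the
    corner. *)
Let cornerM X Y : e * X * e * (e * Y * e) = e * (X * Y) * e.
Proof. by rewrite -!mulrA (mulrA e e) e_idem (mulrA e Y) -e_tri. Qed.

Lemma peirce_decomposition X : X = e * X * e + f * X * f + e * X * f.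
Proof.
rewrite addrAC -mulrDr e_f mulr1.
have -> : f * X * f = f * X by rewrite -[LHS]add0r -(fXe X) -mulrDr e_f mulr1.
by rewrite -mulrDl e_f mul1r.
Qed.

(** * Values of [delta] on the three Peirce blocks *)

Section Forward.
Variable delta : {additive A -> A}.
Hypothesis delta_e : delta e = 0.
(** The product is normalised to [e *+ 2] so that the test pairs need no factor one half. *)
Hypothesis delta_eq : forall X Y, X * Y + Y * X = e *+ 2 ->
  X * delta Y + Y * delta X = 0.

(** Adding [f] to one member of the compressed pair keeps the product [2 e]; multiplying the
    resulting identity by [f] on the left isolates this term. *)
Lemma corner_compl_delta Y Z : Y * Z = 1 -> Z * Y = 1 ->
  f * delta (e * Z * e) = 0.
Proof.
move=> YZ ZY.
have eYZ : e * Y * e * (e * Z * e) = e by rewrite cornerM YZ mulr1 e_idem.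
have eZY : e * Z * e * (e * Y * e) = e by rewrite cornerM ZY mulr1 e_idem.
have /delta_eq : (e * Y * e + f) * (e * Z * e) + e * Z * e * (e * Y * e + f)
    = e *+ 2.
  by rewrite mulrDl mulrDr eYZ eZY -!mulrA ef !mulrA fe !mul0r !mulr0 !addr0.
move=> /(congr1 (fun X => f * X)).
rewrite mulr0 mulrDr mulrA mulrDr !mulrA fe ff !mul0r add0r addr0.
by rewrite -!mulrA.
Qed.

(** The compressed pair has Jordan product [2 e]; the outer compressions drop out because [e] fixes
    the values of [delta] on both members. *)
Lemma corner_inverse Y Z : Y * Z = 1 -> Z * Y = 1 ->
  Y * delta (e * Z * e) + Z * delta (e * Y * e) = 0.
Proof.
move=> YZ ZY.
have delta_corner X X' : X * X' = 1 -> X' * X = 1 ->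
    e * delta (e * X * e) = delta (e * X * e).
  by move=> XX' X'X; apply: e_fix; exact: corner_compl_delta _ _ X'X XX'.
have /delta_eq : e * Y * e * (e * Z * e) + e * Z * e * (e * Y * e) = e *+ 2.
  by rewrite !cornerM YZ ZY mulr1 e_idem.
have eXeZ X T : e * X * e * T = X * (e * T) by rewrite -e_tri mulrA.
by rewrite !eXeZ (delta_corner Z Y)// (delta_corner Y Z).
Qed.

(** Test pair [e + f S f], [e]: since [delta e = 0], a single term survives. *)
Lemma delta_compl_corner S : e * delta (f * S * f) = 0.
Proof.
have : (e + f * S * f) * e + e * (e + f * S * f) = e *+ 2.
  by rewrite mulrDl mulrDr -!mulrA fe !mulrA ef !(mulr0, mul0r) !addr0 e_idem.
by move=> /delta_eq; rewrite raddfD delta_e add0r mulr0 add0r.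
Qed.

(** In the pair [e + S'], [e + T'] the cross terms vanish by orthogonality, and [e] kills [delta S']
    and [delta T']. *)
Lemma delta_compl_anticommute S T :
  f * S * f * (f * T * f) + f * T * f * (f * S * f) = 0 ->
  f * S * f * delta (f * T * f) + f * T * f * delta (f * S * f) = 0.
Proof.
have eX X : e * (f * X * f) = 0 by rewrite !mulrA ef !mul0r.
have Xe X : f * X * f * e = 0 by rewrite -mulrA fe mulr0.
have eD X : e * delta (f * X * f) = 0 by exact: delta_compl_corner.
set S' := f * S * f; set T' := f * T * f => ST.
have /delta_eq : (e + S') * (e + T') + (e + T') * (e + S') = e *+ 2.
  by rewrite !mulrDr !mulrDl !eX !Xe e_idem !addr0 !add0r addrACA ST addr0.
by rewrite !raddfD /= delta_e !add0r !mulrDl !eD !add0r.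
Qed.

(* The pair (e + M, e - M - M S + S) has Jordan product 2 e. *)
Let triangular_relation M S : e * M = M -> M * f = M -> f * S = S -> S * f = S ->
  (e + M) * (delta S - delta M - delta (M * S))
    + (e - M - M * S + S) * delta M = 0.
Proof.
move=> eM Mf fS Sf.
have Me : M * e = 0 by rewrite -Mf -mulrA fe mulr0.
have eS : e * S = 0 by rewrite -fS mulrA ef mul0r.
have Se : S * e = 0 by rewrite -Sf -mulrA fe mulr0.
have MM : M * M = 0 by rewrite -{2}eM mulrA Me mul0r.
have SM : S * M = 0 by rewrite -eM mulrA Se mul0r.
have : (e + M) * (e - M - M * S + S) + (e - M - M * S + S) * (e + M) = e *+ 2.
  rewrite !(mulrDl, mulrDr, mulrBl, mulrBr, mulrN, mulNr) -!mulrA.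
  rewrite Me eS Se MM SM (mulrA M M) MM (mulrA e M) eM e_idem !(mulr0, mul0r).
  rewrite !(subr0, addr0, sub0r, add0r, oppr0).
  by rewrite subrK addrACA addNr addr0 mulr2n.
move=> /delta_eq; rewrite !(raddfD, raddfN) /= delta_e !add0r.
by rewrite (addrC _ (delta S)) addrA.
Qed.

(** Take [S = f] and multiply by [f] on the left: the first summand dies and the coefficient of
    [delta M] becomes [f]. *)
Let compl_delta_off_diagonal M : e * M = M -> M * f = M -> f * delta M = 0.
Proof.
move=> eM Mf.
have /(congr1 (fun X => f * X)) := triangular_relation _ _ eM Mf ff ff.
have fM : f * M = 0 by rewrite -eM mulrA fe mul0r.
have feM : f * (e + M) = 0 by rewrite mulrDr fe fM addr0.
have fW : f * (e - M - M * f + f) = f.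
  by rewrite mulrDr !mulrBr fe mulrA fM ff mul0r !subr0 add0r.
by rewrite mulr0 mulrDr (mulrA f (e + M)) feM mul0r add0r mulrA fW.
Qed.

(** Both [delta M] and [delta (M S)] are fixed by [e] and killed by [M] and [S], so the relation
    collapses to [M delta S - delta (M S) = 0]. *)
Lemma delta_off_diagonal_mul X Y :
  delta (e * X * f * (f * Y * f)) = e * X * f * delta (f * Y * f).
Proof.
have offE Z : e * (e * Z * f) = e * Z * f by rewrite !mulrA e_idem.
have offF Z : e * Z * f * f = e * Z * f by rewrite -mulrA ff.
have fYf : f * (f * Y * f) = f * Y * f by rewrite !mulrA ff.
have fYf' : f * Y * f * f = f * Y * f by rewrite -mulrA ff.
have /= := triangular_relation _ _ (offE X) (offF X) fYf fYf'.
set S := f * Y * f; set M := e * X * f.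
have MS : M * S = e * (X * f * S) * f by rewrite /M /S -!mulrA ff.
have fD Z : f * delta (e * Z * f) = 0 by apply: compl_delta_off_diagonal.
have fM : f * delta M = 0 by exact: fD.
have fMS : f * delta (M * S) = 0 by rewrite MS fD.
have eM : e * delta M = delta M by exact: e_fix.
have eMS : e * delta (M * S) = delta (M * S) by exact: e_fix.
have MfZ Z : f * Z = 0 -> M * Z = 0 by rewrite /M -mulrA => ->; rewrite mulr0.
have SfZ Z : f * Z = 0 -> S * Z = 0 by rewrite /S -mulrA => ->; rewrite mulr0.
rewrite !(mulrDl, mulrBl, mulrDr, mulrN) delta_compl_corner eM eMS.
rewrite (MfZ _ fM) (MfZ _ fMS) (SfZ _ fM) -(mulrA M S) (SfZ _ fM) mulr0.
rewrite !(oppr0, subr0, addr0, sub0r) addrC -!addrA addNKr => /eqP.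
by rewrite addrC subr_eq0 => /eqP.
Qed.

Lemma delta_off_diagonal X : delta (e * X * f) = e * X * f * delta f.
Proof. by have := delta_off_diagonal_mul X 1; rewrite mulr1 ff -mulrA ff. Qed.

End Forward.

(** * The decomposition implies the relation *)

Section Backward.
Variables (alpha beta : {additive A -> A}) (d : A).
Hypothesis alpha_jordan : forall X Y,
  alpha (X * Y + Y * X) = (X * alpha Y) *+ 2 + (Y * alpha X) *+ 2.
Hypothesis beta_corner : forall X, beta X = f * beta (f * X * f) * f.
Hypothesis beta_anticommute : forall X Y,
  f * X * f * Y * f + f * Y * f * X * f = 0 ->
  f * X * beta Y + f * Y * beta X = 0.
Hypothesis beta_off_diagonal : forall X Y,
  e * X * f * beta Y = e * X * f * Y * f * d.

Variable delta : A -> A.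
Hypothesis deltaE : forall X, delta X = alpha X + beta X + e * X * f * d.

(** Splits off the part governed by the anticommutation condition; the rest depends on [X] and [Y]
    only through [X Y], so it can be symmetrised. *)
Let mul_beta_off_diagonal X Y :
  X * (beta Y + e * Y * f * d) = f * X * beta Y + e * (X * Y) * f * d.
Proof.
have f_beta Z : f * beta Z = beta Z by rewrite beta_corner !mulrA ff.
have Xbeta : X * beta Y = f * X * beta Y + e * X * f * Y * f * d.
  by rewrite -beta_off_diagonal -(mulrA _ f) f_beta -!mulrDl addrC e_f mul1r.
have XeY : X * (e * Y * f * d) = e * X * e * Y * f * d by rewrite !mulrA e_tri.
rewrite mulrDr Xbeta XeY -addrA; congr (_ + _).
by rewrite addrC -!mulrDl -mulrDr e_f mulr1 -!mulrA.
Qed.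

Lemma delta_jordan_idempotent X Y : X * Y + Y * X = e ->
  (X * delta Y) *+ 2 + (Y * delta X) *+ 2 = delta e.
Proof.
move=> XY.
(* Compression by [f] is multiplicative too, so [X Y + Y X = e] makes the [f]-corners
   anticommute. *)
have fXYf Z T : f * (Z * T) * f = f * Z * f * T * f.
  rewrite -[in LHS](mul1r T) -e_f mulrDl mulrDr.
  by rewrite mulrDr (mulrA Z) (mulrA f) (mulrA f) fXe mul0r add0r !mulrA.
have jb : f * X * beta Y + f * Y * beta X = 0.
  by apply: beta_anticommute; rewrite -!fXYf -mulrDl -mulrDr XY fe mul0r.
(* The symmetrised off-diagonal terms add up to [e (X Y + Y X) f d = e f d = 0]. *)
have sum_delta : X * delta Y + Y * delta X = X * alpha Y + Y * alpha X.
  rewrite !deltaE -!addrA (mulrDr X) (mulrDr Y) !mul_beta_off_diagonal.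
  rewrite addrACA (addrACA (f * X * _)) jb add0r -!mulrDl -mulrDr XY.
  by rewrite e_idem ef mul0r addr0.
rewrite -mulrnDl sum_delta mulrnDl -alpha_jordan XY deltaE beta_corner e_idem.
by rewrite ef fe !mul0r raddf0 mulr0 mul0r !addr0.
Qed.

End Backward.
End TriangularCompression.

(** * Geometric decay and affine contractions *)

Lemma real_expr_lt (R : realType) (c e : R) : 0 <= c -> c < 1 -> 0 < e ->
  exists n, c ^+ n < e.
Proof.
move=> c0 c1 e0; have /cvg_expr/cvgr0_norm_lt/(_ e e0) : `|c| < 1.
  by rewrite ger0_norm.
by move=> [N _ /(_ N (leqnn N))]; rewrite normrX ger0_norm//; exists N.
Qed.

(** Nonnegative complex scalars are real, so the complex case descends to [R]. *)
Lemma scalar_expr_lt (R : realType) (k : scalar_kind) (c e : scalars R k) :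
  0 <= c -> c < 1 -> 0 < e -> exists n, c ^+ n < e.
Proof.
case: k c e => c e; first exact: real_expr_lt.
move=> c0 c1 e0; have /esym cE := scalar_reK (k := ComplexScalars) c0.
have /esym eE := scalar_reK (k := ComplexScalars) (ltW e0).
move: (scalar_re _) (scalar_re _) cE eE => e' c' /= cE eE.
move: c0 c1 e0; rewrite cE eE (lecR 0) (ltcR _ 1) (ltcR 0) => c0 c1 e0.
have [n cn] := @real_expr_lt R c' e' c0 c1 e0.
by exists n; rewrite -rmorphXn ltcR.
Qed.

Section Neumann.
Context {R : realType} {k : scalar_kind} {H : completeNormedModType (scalars R k)}.
Local Notation K := (scalars R k).

(** Banach iteration from [0], whose iterates are partial Neumann sums. The clause on closed sets
    later places the limit in members of the lattice. *)
Lemma contraction_affine_fixpoint (T : boundedOp H) (c : K) (y : H) :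
  0 <= c -> c < 1 -> (forall x, `|T x| <= c * `|x|) ->
  exists2 x, x = y + T x &
    forall A : set H, closed A -> A 0 -> (forall z, A z -> A (y + T z)) -> A x.
Proof.
move=> c0 c1 Tc; have c1' : 0 < 1 - c by rewrite subr_gt0.
pose u n := iter n (fun x => y + T x) 0.
(* [B] solves [|y| + c B = B], so the iteration preserves the ball of radius [B]. *)
pose B := `|y| / (1 - c).
have B0 : 0 <= B by rewrite divr_ge0// ltW.
have uB n : `|u n| <= B.
  elim: n => [|n IH]; first by rewrite normr0.
  rewrite /= (le_trans (ler_normD _ _))//.
  rewrite (@le_trans _ _ (`|y| + c * B))// ?lerD2l; last first.
    by rewrite -lerBrDr -{1}(mul1r B) -mulrBl mulrC divfK ?gt_eqF.
  by rewrite (le_trans (Tc _))// ler_wpM2l.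
have uC n m : `|u (n + m)%N - u n| <= c ^+ n * B.
  elim: n => [|n IH]; first by rewrite add0n subr0 mul1r.
  rewrite addSn /= opprD addrACA subrr add0r -linearB (le_trans (Tc _))//.
  by rewrite exprS -mulrA ler_wpM2l.
have /cauchy_cvgP/cvg_ex[x /= ux] : cauchy (u @ \oo).
  apply: cauchy_exP => e e0.
  (* [B + 1] is positive even when [y = 0]. *)
  have [N cN] : exists N, c ^+ N < e / (B + 1).
    by apply: scalar_expr_lt => //; rewrite divr_gt0// ltr_wpDl.
  exists (u N); exists N => // n /= Nn; rewrite -ball_normE /= distrC -(subnKC Nn).
  rewrite (le_lt_trans (uC _ _))//.
  rewrite (@le_lt_trans _ _ (c ^+ N * (B + 1)))//.
    by rewrite ler_wpM2l ?exprn_ge0// lerDl.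
  by rewrite -ltr_pdivlMr// ltr_wpDl.
exists x.
  apply/eqP; rewrite -subr_eq0 -normr_le0; apply/ler_addgt0Pl => e e0.
  rewrite addr0.
  have e20 : 0 < e / 2 by rewrite divr_gt0.
  have [N _ uN] : \forall n \near \oo, `|x - u n| < e / 2.
    by move/cvgrPdist_lt : ux => /(_ _ e20).
  have -> : x - (y + T x) = (x - u N.+1) + T (u N - x).
    by rewrite linearB -[u N.+1]/(y + T (u N)) !opprD !addrA subrK.
  rewrite (le_trans (ler_normD _ _))// [leRHS]splitr lerD ?(ltW (uN _ _))//=.
  rewrite (le_trans (Tc _))// (le_trans (ler_piMl _ (ltW c1)))// distrC ltW//.
  by apply: uN => /=.
move=> A Acl A0 AT; apply: closed_cvg ux => //.
by apply: nearW => n; elim: n => [|n IH] //=; apply: AT.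
Qed.

(** * Norm estimates and invertibility in [Alg L] *)

Context {L : subspaceLattice H}.

Lemma Alg_eqP (S T : Alg L) : (forall x : H, S x = T x) -> S = T.
Proof. by move=> ST; apply/val_inj/boundedOpP. Qed.

Lemma ler_Alg_norm (T : Alg L) (x : H) : `|T x| <= `|T| * `|x|.
Proof. exact: ler_opnorm. Qed.

Lemma Alg_norm_le (T : Alg L) (M : K) : 0 <= M ->
  (forall x : H, `|T x| <= M * `|x|) -> `|T| <= M.
Proof. exact: opnorm_le. Qed.

Lemma Alg_scalerAl (a : K) (S T : Alg L) : a *: (S * T) = (a *: S) * T.
Proof. exact: Alg_eqP. Qed.

Lemma Alg_scalerAr (a : K) (S T : Alg L) : a *: (S * T) = S * (a *: T).
Proof. by apply: Alg_eqP => x; rewrite -[LHS](linearZ_LR (Alg_op S)). Qed.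

(** The inverse is built pointwise by solving [x - T x = y]. Uniqueness of the solution gives
    linearity and the second inverse identity; closedness of the lattice members gives
    invariance. *)
Lemma Alg_neumann (T : Alg L) : `|T| < 1 ->
  exists S, (1 - T) * S = 1 /\ S * (1 - T) = 1.
Proof.
move=> T1; have T1' : 0 < 1 - `|T| by rewrite subr_gt0.
have fixT y := contraction_affine_fixpoint _ _ y (normr_ge0 T) T1 (ler_Alg_norm T).
have fix_uniq (x z : H) : x - T x = z - T z -> x = z.
  move=> xz; apply/eqP; rewrite -subr_eq0 -normr_eq0 eq_le normr_ge0 andbT.
  rewrite -(pmulr_rle0 _ T1') mulrBl mul1r subr_le0.
  rewrite (le_trans _ (ler_Alg_norm T _))// linearB.
  suff -> : x - z = T x - T z by [].
  by rewrite -{1}(subrK (T x) x) xz addrAC (addrC z) addrK addrC.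
have /choice[s sP] : forall y : H, exists x : H, x - T x = y /\
    forall A : set H, lattice_set L A -> A y -> A x.
  move=> y; have [x xE xA] := fixT y; exists x; split.
    by rewrite {1}xE addrK.
  move=> A LA Ay; have [Lcl _ _ _ _] := lattice_axiom L.
  have [[A0 Aadd] Acl] := Lcl _ LA; apply: xA => // z Az.
  rewrite -[y]scale1r; apply: Aadd => //.
  by have /leaves_invariantP TL := Alg_subproof T; apply: (TL A LA); exists z.
have s_linear : linear s.
  move=> a x y; apply: fix_uniq; rewrite (sP _).1 linearP opprD addrACA -scalerBr.
  by rewrite !(sP _).1.
have s_bounded x : `|s x| <= (1 - `|T|)^-1 * `|x|.
  rewrite ler_pdivlMl// mulrBl mul1r lerBlDr.
  rewrite -{1}(subrK (T (s x)) (s x)) (sP _).1 (le_trans (ler_normD _ _))//.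
  by rewrite lerD2l ler_Alg_norm.
have s_op : s \in bounded_operator (H := H).
  by apply/bounded_operatorP; split=> //; exists (1 - `|T|)^-1.
have s_inv : BoundedOp s_op \in leaves_invariant L.
  by apply/leaves_invariantP => A LA _ [x Ax <-]; apply: (sP x).2.
exists (MkAlg s_inv); split; apply: Alg_eqP => x; first exact: (sP x).1.
by apply: fix_uniq; rewrite (sP _).1.
Qed.

Lemma Alg_scalar_sub_invertible (T : Alg L) (l : K) : `|T| < `|l| ->
  exists S : Alg L, (l *: (1 : Alg L) - T) * S = 1 /\ S * (l *: (1 : Alg L) - T) = 1.
Proof.
move=> Tl; have l0 : l != 0 by rewrite -normr_gt0 (le_lt_trans _ Tl).
have [|S [TS ST]] := Alg_neumann (l^-1 *: T).
  by rewrite normrZ normfV mulrC ltr_pdivrMr ?normr_gt0// mul1r.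
have -> : l *: (1 : Alg L) - T = l *: (1 - l^-1 *: T).
  by rewrite scalerBr scalerA divff// scale1r.
exists (l^-1 *: S).
by rewrite -!Alg_scalerAl -!Alg_scalerAr !scalerA divff// mulVf// TS ST !scale1r.
Qed.

Definition sandwich (P Q X : Alg L) : Alg L := P * X * Q.

Fact sandwich_linear P Q : linear (sandwich P Q).
Proof.
by move=> a X Y; rewrite /sandwich mulrDr mulrDl -Alg_scalerAr -Alg_scalerAl.
Qed.

HB.instance Definition _ P Q :=
  GRing.isLinear.Build K (Alg L) (Alg L) *:%R (sandwich P Q) (sandwich_linear P Q).

Lemma ler_Alg_normM (S T : Alg L) : `|S * T| <= `|S| * `|T|.
Proof.
apply: Alg_norm_le => [|x]; first by rewrite mulr_ge0.
rewrite (le_trans (ler_Alg_norm S _))// -mulrA ler_wpM2l//.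
exact: ler_Alg_norm.
Qed.

Lemma sandwich_continuous P Q : continuous (sandwich P Q).
Proof.
apply: bounded_linear_continuous; apply/bounded_funP => r.
exists (`|P| * r * `|Q|) => X Xr.
rewrite (le_trans (ler_Alg_normM _ _))// ler_wpM2r//.
by rewrite (le_trans (ler_Alg_normM _ _))// ler_wpM2l.
Qed.

(** As [D 1 = 0], replacing [X] by [X + l] adds [2 l D X] to both sides of the square identity, so
    it suffices to prove it for a translate. *)
Lemma jordan_left_derivation_of_inverses (D : {linear Alg L -> Alg L}) :
  (forall Y Z, Y * Z = 1 -> Z * Y = 1 -> Y * D Z + Z * D Y = 0) ->
  jordan_left_derivation D.
Proof.
move=> DI.
have D1 : D 1 = 0.
  have := DI 1 1 (mulr1 1) (mulr1 1); rewrite !mul1r -mulr2n -scaler_nat => /eqP.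
  by rewrite scaler_eq0 pnatr_eq0 /= => /eqP.
apply: jordan_of_square => X.
(* Both [X + l] and [1 - (X + l)] are invertible for this [l]. *)
pose l := `|X| + 2%:R : K.
have l1 : `|- X| < `|l|.
  by rewrite normrN ger0_norm ?addr_ge0// ltrDl ltr0n.
have l2 : `|X| < `|1 - l|.
  rewrite distrC ger0_norm /l mulr2n addrA addrK ?addr_ge0// ltrDl.
  exact: ltr01.
have [X' [XX' X'X]] := Alg_scalar_sub_invertible _ _ l1.
have [V' [VV' V'V]] := Alg_scalar_sub_invertible _ _ l2.
have VE : (1 - l) *: (1 : Alg L) - X = 1 - (l *: (1 : Alg L) - - X).
  by rewrite opprK scalerBl scale1r opprD addrA.
rewrite VE in VV' V'V.
have := jordan_square_of_inverses _ _ D1 DI _ _ _ XX' X'X VV' V'V.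
have DZ Y : D (l *: Y) = l *: D Y by rewrite linearZ.
rewrite opprK !mulrDl !mulrDr -!Alg_scalerAl -!Alg_scalerAr !mul1r !mulr1.
rewrite !raddfD /= !DZ D1 !scaler0 !add0r addrA -mulr2n mulrnDl.
exact: addrI.
Qed.

End Neumann.

(** * Assembling the characterization *)

Lemma range_invariant (R : realType) (k : scalar_kind)
    (H : completeNormedModType (scalars R k)) (L : subspaceLattice H) (P : Alg L) :
  P * P = P -> lattice_set L (range P) -> forall X : Alg L, X * P = P * X * P.
Proof.
move=> PP LP X; apply: Alg_eqP => x.
have /leaves_invariantP XL := Alg_subproof X.
have [y _ Py] : range P (X (P x)) by apply: (XL _ LP); exists (P x) => //; exists x.
(* An idempotent fixes its range pointwise. *)
change (X (P x) = P (X (P x))); rewrite -Py.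
by change (P y = (P * P) y); rewrite PP.
Qed.

Theorem theorem2p5 (R : realType) (k : scalar_kind)
  (H : completeNormedModType (scalars R k))
  (dot : {dot H for @scalar_conj R k})
  (dot_norm : forall x : H, dot x x = `|x| ^+ 2)
  (L : subspaceLattice H)
  (P : Alg L)
  (P_idempotent : P * P = P)
  (P_neq0 : P <> 0) (P_neq1 : P <> 1)
  (P_range : lattice_set L (range P))
  (delta : {linear Alg L -> Alg L})
  (delta_cont : continuous delta) :
  (forall A B : Alg L, A * B + B * A = P ->
     (A * delta B) *+ 2 + (B * delta A) *+ 2 = delta P)
  <->
  (exists alpha beta : {linear Alg L -> Alg L},
    [/\ forall A : Alg L,
          delta A = alpha A + beta A + P * A * (1 - P) * delta 1,
        [/\ continuous alpha,
            jordan_left_derivation alpha &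
            forall A : Alg L, alpha A = P * alpha (P * A * P)] &
        [/\ continuous beta,
            forall A : Alg L,
              beta A = (1 - P) * beta ((1 - P) * A * (1 - P)) * (1 - P),
            forall A B : Alg L,
              (1 - P) * A * (1 - P) * B * (1 - P)
                + (1 - P) * B * (1 - P) * A * (1 - P) = 0 ->
              (1 - P) * A * beta B + (1 - P) * B * beta A = 0 &
            forall A B : Alg L,
              P * A * (1 - P) * beta B
                = P * A * (1 - P) * B * (1 - P) * delta 1]]).
Proof.
have e_f : P + (1 - P) = 1 by rewrite addrC subrK.
have e_tri := range_invariant _ _ _ _ _ P_idempotent P_range.
have half (Z : Alg L) : (2^-1 *: Z) *+ 2 = Z.
  by rewrite -scaler_nat scalerA divff ?scale1r// pnatr_eq0.
split=> [delta_eq|[alpha [beta [deltaE [_ aJ _] [_ bE bZ bO]]]]]; last first.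
  exact: (delta_jordan_idempotent e_f P_idempotent e_tri alpha beta (delta 1)
    aJ bE bZ bO delta deltaE).
(* The pair [P], [P / 2] gives [2 P delta(P) = delta(P)]; multiplying by [P] forces
   [P delta(P) = 0]. *)
have delta_P : delta P = 0.
  have := delta_eq P (2^-1 *: P).
  rewrite -Alg_scalerAr -Alg_scalerAl P_idempotent -mulr2n half => /(_ erefl).
  rewrite linearZ -Alg_scalerAr -Alg_scalerAl half -mulr2n => E.
  have := congr1 (fun X => P * X) E.
  rewrite mulrnAr mulrA P_idempotent mulr2n -[RHS]addr0 => /addrI PD.
  by rewrite -E PD mul0rn.
have delta_eq2 (X Y : Alg L) : X * Y + Y * X = P *+ 2 -> X * delta Y + Y * delta X = 0.
  move=> XY; have := delta_eq X (2^-1 *: Y).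
  rewrite -Alg_scalerAr -Alg_scalerAl -scalerDr XY -scalerMnr half => /(_ erefl).
  by rewrite linearZ /= -Alg_scalerAr -Alg_scalerAl !half delta_P.
have comp_delta := delta_compl_corner e_f P_idempotent _ delta_P delta_eq2.
have off_delta := delta_off_diagonal e_f P_idempotent _ delta_P delta_eq2.
have off_mul := delta_off_diagonal_mul e_f P_idempotent _ delta_P delta_eq2.
have delta_1 : delta 1 = delta (1 - P) by rewrite linearB delta_P subr0.
have compl_mulP : (1 - P) * P = 0 by rewrite mulrBl mul1r P_idempotent subrr.
have mulP_compl : P * (1 - P) = 0 by rewrite mulrBr mulr1 P_idempotent subrr.
have compl_idem : (1 - P) * (1 - P) = 1 - P.
  by rewrite mulrBl mul1r mulP_compl subr0.
have corner_delta (X : Alg L) : P * delta (P * X * P) = delta (P * X * P).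
  (* [X + l] is invertible for this [l], and the translation only adds [l P] to the corner, where
     [delta] vanishes. *)
  pose l : scalars R k := `|X| + 1.
  have l_gt : `|- X| < `|l| by rewrite normrN ger0_norm ?addr_ge0// ltrDl.
  have [Y [XY YX]] := Alg_scalar_sub_invertible _ _ l_gt.
  have := corner_compl_delta e_f P_idempotent e_tri _ delta_eq2 _ _ YX XY.
  rewrite opprK mulrDr mulrDl -Alg_scalerAr mulr1 -Alg_scalerAl P_idempotent.
  have delta_lP : delta (l *: P) = 0 by rewrite linearZ /= delta_P scaler0.
  rewrite raddfD /= delta_lP add0r mulrBl mul1r => /eqP.
  by rewrite subr_eq0 => /eqP.
have compl_delta (X : Alg L) :
    (1 - P) * delta ((1 - P) * X * (1 - P)) = delta ((1 - P) * X * (1 - P)).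
  by rewrite mulrBl mul1r comp_delta subr0.
have compl_corner_delta (X : Alg L) :
    (1 - P) * delta ((1 - P) * X * (1 - P)) * (1 - P)
    = delta ((1 - P) * X * (1 - P)).
  have mul_compl Y : (1 - P) * Y * (1 - P) = (1 - P) * Y.
    by rewrite mulrBr mulr1 -mulrA e_tri !mulrA compl_mulP !mul0r subr0.
  by rewrite mul_compl compl_delta.
(* The diagonal Peirce corners define [alpha] and [beta]; the off-diagonal one yields the remaining
   term of [delta]. *)
pose alpha : {linear Alg L -> Alg L} := delta \o sandwich P P.
pose beta : {linear Alg L -> Alg L} := delta \o sandwich (1 - P) (1 - P).
have alphaE X : alpha X = delta (P * X * P) by [].
have betaE X : beta X = delta ((1 - P) * X * (1 - P)) by [].
exists alpha, beta; split=> [X||].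
- rewrite {1}(peirce_decomposition e_f P_idempotent e_tri X) !linearD /=.
  by rewrite off_delta delta_1.
- split=> [X||X].
  + by apply: continuous_comp; [exact: sandwich_continuous|exact: delta_cont].
  + apply: jordan_left_derivation_of_inverses => Y Z YZ ZY.
    exact: (corner_inverse e_f P_idempotent e_tri _ delta_eq2 _ _ YZ ZY).
  + by rewrite !alphaE !mulrA P_idempotent -!mulrA P_idempotent !mulrA corner_delta.
- split=> [X|X|X Y XY|X Y].
  + by apply: continuous_comp; [exact: sandwich_continuous|exact: delta_cont].
  + rewrite !betaE !mulrA compl_idem -!(mulrA _ (1 - P) (1 - P)) compl_idem.
    by rewrite compl_corner_delta.
  + rewrite !betaE -(compl_delta X) -(compl_delta Y) !mulrA.
    apply: (delta_compl_anticommute e_f P_idempotent _ delta_P delta_eq2).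
    by rewrite !mulrA -!(mulrA _ (1 - P) (1 - P)) compl_idem.
  (* An off-diagonal block times a corner block is again off-diagonal, so [delta] of the product is
     evaluated in two ways. *)
  + rewrite betaE -off_mul.
    have -> : P * X * (1 - P) * ((1 - P) * Y * (1 - P))
        = P * (X * (1 - P) * Y) * (1 - P).
      by rewrite !mulrA -(mulrA (P * X)) compl_idem.
    by rewrite off_delta delta_1 !mulrA.
Qed.
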